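(* Let $S_p=S_{\tau,\eta,\mu}(P)$ and $S_q=S_{\tau,\eta,0}(Q)$ be the symbolic systems of a plant $P$ and a specification $Q$, let $C^\ast=S_p\parallel_0S_q$, and let $C^{\ast\ast}$ be the system output by the integrated symbolic control design algorithm described in the context. Then $Nb(C^\ast)$ and $C^{\ast\ast}$ are exactly bisimilar, i.e. there is a $0$-approximate bisimulation relation between $Nb(C^\ast)$ and $C^{\ast\ast}$.
   Context: $\|\cdot\|$ is the infinity norm on $\mathbb R^n$. A control system is $\Sigma=(X,X_0,U,\mathcal U,f)$ with $X\subseteq\mathbb R^n$, $X_0\subseteq X$, $U\subseteq\mathbb R^m$, $\mathcal U$ a subset of the locally essentially bounded functions from intervals $]a,b[$ ($a<0<b$) to $U$, and $f:\mathbb R^n\times U\to\mathbb R^n$ continuous and Lipschitz in $x$ on compact sets uniformly in $u\in U$. A trajectory is a curve $\xi$ with $\dot\xi=f(\xi,u)$ a.e.; $\xi_{xu}(\tau)$ is the point reached at time $\tau$ from $x$ under $u$. Forward complete: every trajectory is defined on an interval $]a,\infty[$. $\Sigma$ is $\delta$-ISS if it is forward complete and $\|\xi_{xu}(t)-\xi_{x'u'}(t)\|\le\beta(\|x-x'\|,t)+\gamma(\|u-u'\|_\infty)$ for all $t\ge0$, $x,x'\in\mathbb R^n$, $u,u'\in\mathcal U$, for some continuous $\gamma$ strictly increasing, unbounded with $\gamma(0)=0$ ($\mathcal K_\infty$) and some continuous $\beta$ with $\beta(\cdot,s)\in\mathcal K_\infty$ and $\beta(r,\cdot)$ decreasing to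 $0$ ($\mathcal{KL}$). Setting. $P=(X_p,X_{p,0},U_p,\mathcal U_p,f_p)$ is a control system; $Q=(X_q,X_{q,0},U_q,\mathcal U_q,f_q)$ is an autonomous system $\dot x=g_q(x)$, viewed as a control system with $U_q=\{0\}$ and only the null input. $X_p$, $U_p$, $X_q$ are bounded. $P$ and $Q$ are $\delta$-ISS with functions $\beta_p,\gamma_p$ and $\beta_q$. Given $\varepsilon>0$, parameters $\theta_p,\theta_q,\tau,\eta,\mu>0$ satisfy $\theta_p+\theta_q\le\varepsilon$, $\beta_p(\theta_p,\tau)+\gamma_p(\mu)+\eta\le\theta_p$, $\beta_q(\theta_q,\tau)+\eta\le\theta_q$. A system is $S=(X,X_0,U,\to,Y,H)$ with states $X$, initial states $X_0\subseteq X$, inputs $U$, transitions $\to\subseteq X\times U\times X$, output set $Y$, output map $H:X\to Y$; metric if $Y$ has a metric $d$; non-blocking if every state has an outgoing transition. $S_1\sqsubseteq S_2$ (sub-system) if all of $X_1,X_{0,1},U_1,\to_1,Y_1$ are contained in the corresponding sets of $S_2$ and $H_1=H_2$ on $X_1$. $Nb(S)$ is the non-blocking sub-system of $S$ such that $S'\sqsubseteq Nb(S)$ for every non-blocking $S'\sqsubseteq S$. $\mathcal R\subseteq X_1\times X_2$ is an $\varepsilon$-approximate simulation relation from $S_1$ to $S_2$ if each $x_1\in X_{0,1}$ is related to some $x_2\in X_{0,2}$; related states satisfy $d(H_1(x_1),H_2(x_2))\le\varepsilon$; and for $(x_1,x_2)\in\mathcal R$ any $x_1\xrightarrow{u_1}x_1'$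 is matched by some $x_2\xrightarrow{u_2}x_2'$ with $(x_1',x_2')\in\mathcal R$. It is an $\varepsilon$-approximate bisimulation relation if moreover $\mathcal R^{-1}$ is an $\varepsilon$-approximate simulation relation from $S_2$ to $S_1$. $S_1\parallel_0S_2$ has states $\{(x_1,x_2):H_1(x_1)=H_2(x_2)\}$, initial states those with $x_i\in X_{0,i}$, inputs $U_1\times U_2$, transitions $(x_1,x_2)\xrightarrow{(u_1,u_2)}(x_1',x_2')$ between such states whenever $x_i\xrightarrow{u_i}x_i'$ for $i=1,2$, and output map $(x_1,x_2)\mapsto H_1(x_1)$. All outputs are regarded in $\mathbb R^n$ with $d(p,q)=\|p-q\|$. $[A]_\mu=\{a\in A:a_i=k_i\mu,\ k_i\in\mathbb Z\}$; $\mathcal B_{[\eta[}(y)=\prod_i[y_i-\eta,y_i+\eta[$. $S_{\tau,\eta,\mu}(\Sigma)$ has states $[X]_{2\eta}$, initial states $[X]_{2\eta}\cap X_0$, inputs $[U]_{2\mu}$ (as constant inputs on $[0,\tau]$), transitions $x\xrightarrow{u}y$ iff $\xi_{xu}(\tau)\in\mathcal B_{[\eta[}(y)\cap X$ (so there is at most one successor $y$ for each $x,u$), output map the inclusion; for $Q$, $\mu=0$ means the input set is $\{0\}$. Algorithm. For a set $T$ of triples, $\mathbf X_{source}(T)=\{x:\exists u,y,\ (x,u,y)\in T\}$. Initialize $X_0:=[X_{p,0}\cap X_{q,0}]_{2\eta}$, $\mathbf X_{target}:=X_0$, $T:=\varnothing$, $Bad:=\varnothing$. While there is $x\in[X_p\cap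 X_q]_{2\eta}$ with $x\in\mathbf X_{target}\setminus(\mathbf X_{source}(T)\cup Bad)$, take such an $x$ and: compute the successor $y$ of $x$ in $S_q$; if $y$ exists and $y\notin Bad$, run through the inputs $u\in[U_p]_{2\mu}$, computing the $u$-successor $z$ of $x$ in $S_p$, stopping as soon as some $u$ gives $z=y$; if such $u$ is found, add $(x,u,y)$ to $T$ and $y$ to $\mathbf X_{target}$. Otherwise (no $y$, or $y\in Bad$, or no such $u$) set $(T,Bad):=\mathbf{NonBlock}(T,x,Bad)$. Function $\mathbf{NonBlock}(T,x,Bad)$: set $Badx:=\{x\}$; while $Badx\ne\varnothing$ take $y\in Badx$; for each $z\in\mathbf X_{source}(T)$, if $(z,u,y)\in T$ for some $u$, remove this triple from $T$ and add $z$ to $Badx$; then remove $y$ from $Badx$ and add $y$ to $Bad$; finally return $(T,Bad)$. Output: $C^{\ast\ast}=(\mathbf X_{source}(T),\,X_0\cap\mathbf X_{source}(T),\,[U_p]_{2\mu},\,T,\,Y,\,H)$ with $H$ the inclusion of $\mathbf X_{source}(T)$ into the output space $Y$ of $S_p$. *)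

(* Defs.v *)
(* [`|x|] on ['rV[R]_n] is the infinity norm. *)
From HB Require Import structures.
From mathcomp Require Import all_boot all_order all_algebra.
From mathcomp Require Import all_classical all_reals all_analysis.
From mathcomp Require Import ess_sup_inf.

Set Implicit Arguments.
Unset Strict Implicit.
Unset Printing Implicit Defensive.

Import Order.TTheory GRing.Theory Num.Theory.
Import numFieldNormedType.Exports.

Local Open Scope classical_set_scope.
Local Open Scope ring_scope.

(* The interval ]a, b[ with possibly infinite end points. *)
Definition eitv (R : realType) (a b : \bar R) : set R :=
  [set t : R | (a < t%:E)%E /\ (t%:E < b)%E].

(* An input on ]in_lo, in_hi[; the values of [in_fun] elsewhere are junk. *)
Record input (R : realType) (m : nat) := Input {
  in_lo : \bar R;
  in_hi : \bar R;
  in_fun :> R -> 'rV[R]_m }.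

Definition input_dom (R : realType) (m : nat) (u : input R m) : set R :=
  eitv (in_lo u) (in_hi u).

Record admissible (R : realType) (m : nat) (U : set 'rV[R]_m) (u : input R m)
    : Prop := Admissible {
  adm_dom : (in_lo u < 0)%E /\ (0 < in_hi u)%E;
  adm_val : forall t, input_dom u t -> U (u t);
  adm_meas : forall j, measurable_fun (input_dom u) (fun t => u t 0 j);
  adm_bound : forall c d : R, input_dom u c -> input_dom u d ->
    exists M : R,
      {ae @lebesgue_measure R, forall t, c <= t <= d -> `|u t| <= M} }.

Record ctrl_system (R : realType) (n m : nat) := CtrlSystem {
  cs_X : set 'rV[R]_n;
  cs_X0 : set 'rV[R]_n;
  cs_U : set 'rV[R]_m;
  cs_inputs : set (input R m);
  cs_f : 'rV[R]_n -> 'rV[R]_m -> 'rV[R]_n;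
  cs_X0_sub : cs_X0 `<=` cs_X;
  cs_inputs_adm : forall u, cs_inputs u -> admissible cs_U u;
  cs_f_cont : {within [set p : 'rV[R]_n * 'rV[R]_m | cs_U p.2],
                 continuous (fun p => cs_f p.1 p.2)};
  cs_f_lip : forall K : set 'rV[R]_n, compact K ->
    exists L : R, forall x y u, K x -> K y -> cs_U u ->
      `|cs_f x u - cs_f y u| <= L * `|x - y| }.

(* Absolute continuity of a curve on [c, d]: the intervals
   ](I i).1, (I i).2[ are pairwise disjoint. *)
Definition abs_cont (R : realType) (n : nat) (xi : R -> 'rV[R]_n) (c d : R)
    : Prop :=
  forall e : R, 0 < e -> exists2 dl : R, 0 < dl &
    forall (k : nat) (I : 'I_k -> R * R),
      (forall i, c <= (I i).1 /\ (I i).1 <= (I i).2 /\ (I i).2 <= d) ->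
      (forall i j, i != j -> (I i).2 <= (I j).1 \/ (I j).2 <= (I i).1) ->
      \sum_i ((I i).2 - (I i).1) < dl ->
      \sum_i `|xi (I i).2 - xi (I i).1| < e.

(* [xi] restricted to ]a, b[ is a (Caratheodory) trajectory under [u]. *)
Record trajectory (R : realType) (n m : nat) (S : ctrl_system R n m)
    (u : input R m) (a b : \bar R) (xi : R -> 'rV[R]_n) : Prop := Trajectory {
  traj_input : cs_inputs S u;
  traj_dom : (a < 0)%E /\ (0 < b)%E;
  traj_sub : (in_lo u <= a)%E /\ (b <= in_hi u)%E;
  traj_ac : forall c d : R, eitv a b c -> eitv a b d -> abs_cont xi c d;
  traj_eq : {ae @lebesgue_measure R, forall t, eitv a b t ->
               is_derive (t : R^o) (1 : R^o) xi (cs_f S (xi t) (u t))} }.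

(* [reach S u x t z]: the point xi_{x u}(t) is defined and equals [z]. *)
Definition reach (R : realType) (n m : nat) (S : ctrl_system R n m)
    (u : input R m) (x : 'rV[R]_n) (t : R) (z : 'rV[R]_n) : Prop :=
  exists (a b : \bar R) (xi : R -> 'rV[R]_n),
    [/\ trajectory S u a b xi, xi 0 = x, eitv a b t & xi t = z].

(* Restrictions of trajectories being trajectories, "defined on ]a, oo["
   is required up to extension. *)
Definition forward_complete (R : realType) (n m : nat)
    (S : ctrl_system R n m) : Prop :=
  forall u a b xi, trajectory S u a b xi ->
    exists2 xi', trajectory S u a +oo%E xi' &
      forall t, eitv a b t -> xi' t = xi t.

Definition class_Koo (R : realType) (g : R -> R) : Prop :=
  [/\ {within `[0, +oo[, continuous g},
      g 0 = 0,
      forall r s, 0 <= r -> r < s -> g r < g s &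
      forall M : R, exists2 r, 0 <= r & M < g r].

(* "Decreasing" is not strict, since beta(0, .) = 0. *)
Definition class_KL (R : realType) (beta : R -> R -> R) : Prop :=
  [/\ {within [set p : R * R | 0 <= p.1 /\ 0 <= p.2],
         continuous (fun p => beta p.1 p.2)},
      forall s, 0 <= s -> class_Koo (beta ^~ s),
      forall r s t, 0 <= r -> 0 <= s -> s <= t -> beta r t <= beta r s &
      forall r, 0 <= r -> beta r s @[s --> +oo] --> (0 : R)].

(* ||u - u'||_oo, the essential supremum over t >= 0. *)
Definition input_dist (R : realType) (m : nat) (u u' : input R m) : \bar R :=
  ess_sup (@lebesgue_measure R)
    (fun t : R => if 0 <= t then `|u t - u' t|%:E else 0%E).

(* The bound is void when ||u - u'||_oo = +oo. *)
Definition dISS (R : realType) (n m : nat) (S : ctrl_system R n m)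
    (beta : R -> R -> R) (gamma : R -> R) : Prop :=
  [/\ forward_complete S, class_KL beta, class_Koo gamma &
      forall (t : R) (x x' z z' : 'rV[R]_n) (u u' : input R m),
        0 <= t -> cs_inputs S u -> cs_inputs S u' ->
        reach S u x t z -> reach S u' x' t z' ->
        (input_dist u u' < +oo)%E ->
        `|z - z'| <= beta `|x - x'| t + gamma (fine (input_dist u u'))].

Definition null_input (R : realType) (m : nat) : input R m :=
  Input -oo%E +oo%E (fun _ => 0).

Definition autonomous (R : realType) (n m : nat) (S : ctrl_system R n m)
    (g : 'rV[R]_n -> 'rV[R]_n) : Prop :=
  [/\ cs_U S = [set 0], cs_inputs S = [set null_input R m] &
      forall x, cs_f S x 0 = g x].

Record system (St In Out : Type) := System {
  st : set St;
  st0 : set St;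
  inp : set In;
  tr : St -> In -> St -> Prop;
  out : set Out;
  omap : St -> Out }.

Record is_system (St In Out : Type) (S : system St In Out) : Prop := IsSystem {
  sys_st0 : st0 S `<=` st S;
  sys_tr : forall x u y, tr S x u y -> [/\ st S x, inp S u & st S y];
  sys_omap : forall x, st S x -> out S (omap S x) }.

Definition non_blocking (St In Out : Type) (S : system St In Out) : Prop :=
  forall x, st S x -> exists u y, tr S x u y.

Record subsystem (St In Out : Type) (S1 S2 : system St In Out) : Prop :=
  Subsystem {
  sub_st : st S1 `<=` st S2;
  sub_st0 : st0 S1 `<=` st0 S2;
  sub_inp : inp S1 `<=` inp S2;
  sub_tr : forall x u y, tr S1 x u y -> tr S2 x u y;
  sub_out : out S1 `<=` out S2;
  sub_omap : forall x, st S1 x -> omap S1 x = omap S2 x }.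

(* [is_Nb S N]: N is Nb(S).  The output map of N is determined on the states of
   N only, whence a predicate rather than a function. *)
Record is_Nb (St In Out : Type) (S N : system St In Out) : Prop := IsNb {
  Nb_system : is_system N;
  Nb_non_blocking : non_blocking N;
  Nb_sub : subsystem N S;
  Nb_max : forall S', is_system S' -> non_blocking S' -> subsystem S' S ->
    subsystem S' N }.

Lemma Nb_exists (St In Out : Type) (S : system St In Out) :
  exists N, is_Nb S N.
Proof.
pose nbs S' := [/\ is_system S', non_blocking S' & subsystem S' S].
exists (System [set x | exists2 S', nbs S' & st S' x]
  [set x | exists2 S', nbs S' & st0 S' x] (inp S)
  (fun x u y => exists2 S', nbs S' & tr S' x u y) (out S) (omap S)).
split; [split | | split | ] => //=.
- by move=> x [S' [sS' nS' lS'] xS']; exists S'; [split | exact: sys_st0 xS'].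
- move=> x u y [S' [sS' nS' lS'] xy]; have [xS' uS' yS'] := sys_tr sS' xy.
  by split; [exists S' | exact: sub_inp lS' _ uS' | exists S'].
- move=> x [S' [sS' nS' lS'] xS']; rewrite -(sub_omap lS' xS').
  exact/(sub_out lS')/sys_omap.
- move=> x [S' [sS' nS' lS'] xS']; have [u [y xy]] := nS' _ xS'.
  by exists u, y, S'.
- by move=> x [S' [sS' nS' lS'] xS']; exact: sub_st lS' _ xS'.
- by move=> x [S' [sS' nS' lS'] xS']; exact: sub_st0 lS' _ xS'.
- by move=> x u y [S' [sS' nS' lS'] xy]; exact: sub_tr lS' _ _ _ xy.
move=> S' sS' nS' lS'; split => //=.
- by move=> x xS'; exists S'.
- by move=> x xS'; exists S'.
- exact: sub_inp lS'.
- by move=> x u y xy; exists S'.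
- exact: sub_out lS'.
- exact: sub_omap lS'.
Qed.

Record approx_sim (R : realType) (k : nat) (St1 In1 St2 In2 : Type)
    (S1 : system St1 In1 'rV[R]_k) (S2 : system St2 In2 'rV[R]_k)
    (eps : R) (rel : St1 -> St2 -> Prop) : Prop := ApproxSim {
  sim_st : forall x1 x2, rel x1 x2 -> st S1 x1 /\ st S2 x2;
  sim_st0 : forall x1, st0 S1 x1 -> exists2 x2, st0 S2 x2 & rel x1 x2;
  sim_out : forall x1 x2, rel x1 x2 -> `|omap S1 x1 - omap S2 x2| <= eps;
  sim_tr : forall x1 x2 u1 y1, rel x1 x2 -> tr S1 x1 u1 y1 ->
    exists u2 y2, tr S2 x2 u2 y2 /\ rel y1 y2 }.

Definition approx_bisim (R : realType) (k : nat) (St1 In1 St2 In2 : Type)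
    (S1 : system St1 In1 'rV[R]_k) (S2 : system St2 In2 'rV[R]_k)
    (eps : R) (rel : St1 -> St2 -> Prop) : Prop :=
  approx_sim S1 S2 eps rel /\ approx_sim S2 S1 eps (fun x2 x1 => rel x1 x2).

(* The exact (0-approximate) parallel composition. *)
Definition compose0 (St1 In1 St2 In2 Out : Type)
    (S1 : system St1 In1 Out) (S2 : system St2 In2 Out)
    : system (St1 * St2) (In1 * In2) Out :=
  let X := [set x | [/\ st S1 x.1, st S2 x.2 & omap S1 x.1 = omap S2 x.2]] in
  System X
    [set x | [/\ X x, st0 S1 x.1 & st0 S2 x.2]]
    [set u | inp S1 u.1 /\ inp S2 u.2]
    (fun x u y => [/\ X x, X y, tr S1 x.1 u.1 y.1 & tr S2 x.2 u.2 y.2])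
    (out S1)
    (fun x => omap S1 x.1).

(* [A]_mu *)
Definition lattice (R : realType) (k : nat) (mu : R) (A : set 'rV[R]_k)
    : set 'rV[R]_k :=
  [set a | A a /\ forall i, exists z : int, a 0 i = z%:~R * mu].

(* B_{[eta[}(y) *)
Definition box (R : realType) (k : nat) (eta : R) (y : 'rV[R]_k)
    : set 'rV[R]_k :=
  [set z | forall i, y 0 i - eta <= z 0 i /\ z 0 i < y 0 i + eta].

(* S_{tau, eta, mu}; the input set for mu = 0 is [U]_0 = U `&` [set 0].
   A symbol u stands for the inputs of the control system that are equal
   to u on [0, tau]. *)
Definition symbolic (R : realType) (n m : nat) (S : ctrl_system R n m)
    (tau eta mu : R) : system 'rV[R]_n 'rV[R]_m 'rV[R]_n :=
  let X := lattice (2 * eta) (cs_X S) in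
  let U := lattice (2 * mu) (cs_U S) in
  System X (X `&` cs_X0 S) U
    (fun x u y => [/\ X x, U u, X y &
       exists (v : input R m) (z : 'rV[R]_n),
         [/\ cs_inputs S v, forall t, 0 <= t <= tau -> v t = u,
             reach S v x tau z & (box eta y `&` cs_X S) z]])
    setT id.

(* [while_loop guard body s s']: the loop [while guard do body], with
   nondeterministic [body], started in [s] may terminate in [s']. *)
Inductive while_loop (A : Type) (guard : A -> Prop) (body : A -> A -> Prop)
    : A -> A -> Prop :=
| while_stop s : ~ guard s -> while_loop guard body s s
| while_step s s1 s' : guard s -> body s s1 ->
    while_loop guard body s1 s' -> while_loop guard body s s'.

Definition source (St In : Type) (T : set (St * In * St)) : set St :=
  [set x | exists u y, T (x, u, y)].

Record nonblock_state (St In : Type) := NonBlockState {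
  nb_T : set (St * In * St);
  nb_Badx : set St;
  nb_Bad : set St }.

Definition nonblock_body (St In : Type) (s s' : nonblock_state St In) : Prop :=
  exists2 y, nb_Badx s y &
    s' = NonBlockState
      [set t | nb_T s t /\ t.2 <> y]
      ((nb_Badx s `|` [set z | exists u, nb_T s (z, u, y)]) `\ y)
      (nb_Bad s `|` [set y]).

(* [NonBlock T x Bad T' Bad']: NonBlock(T, x, Bad) may return (T', Bad'). *)
Definition NonBlock (St In : Type) (T : set (St * In * St)) (x : St)
    (Bad : set St) (T' : set (St * In * St)) (Bad' : set St) : Prop :=
  exists2 s', while_loop (fun s => nb_Badx s !=set0) (@nonblock_body St In)
                (NonBlockState T [set x] Bad) s' &
    nb_T s' = T' /\ nb_Bad s' = Bad'.

Record design_state (St In : Type) := DesignState {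
  ds_target : set St;
  ds_T : set (St * In * St);
  ds_Bad : set St }.

Section Design.
Context (R : realType) (n m mq : nat).
Context (P : ctrl_system R n m) (Q : ctrl_system R n mq) (tau eta mu : R).

Let Sp := symbolic P tau eta mu.
Let Sq := symbolic Q tau eta 0.
Let dstate := design_state 'rV[R]_n 'rV[R]_m.

Definition design_X0 : set 'rV[R]_n :=
  lattice (2 * eta) (cs_X0 P `&` cs_X0 Q).

Definition design_init : dstate := DesignState design_X0 set0 set0.

Definition design_pending (s : dstate) (x : 'rV[R]_n) : Prop :=
  [/\ lattice (2 * eta) (cs_X P `&` cs_X Q) x, ds_target s x,
      ~ source (ds_T s) x & ~ ds_Bad s x].

Definition design_guard (s : dstate) : Prop :=
  exists x, design_pending s x.

(* The input u reaches in Sp the successor y of x in Sq. *)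
Definition design_match (x : 'rV[R]_n) (u : 'rV[R]_m) (y : 'rV[R]_n) : Prop :=
  tr Sq x 0 y /\ tr Sp x u y.

Definition design_body (s s' : dstate) : Prop :=
  exists2 x, design_pending s x &
    (exists u y, [/\ design_match x u y, ~ ds_Bad s y &
       s' = DesignState (ds_target s `|` [set y])
              (ds_T s `|` [set (x, u, y)]) (ds_Bad s)])
    \/
    [/\ forall y, tr Sq x 0 y -> ds_Bad s y \/ ~ exists u, design_match x u y,
        ds_target s' = ds_target s &
        NonBlock (ds_T s) x (ds_Bad s) (ds_T s') (ds_Bad s')].

(* [design_output C]: some terminating run returns C. *)
Definition design_output (C : system 'rV[R]_n 'rV[R]_m 'rV[R]_n) : Prop :=
  exists2 s, while_loop design_guard design_body design_init s &
    C = System (source (ds_T s)) (design_X0 `&` source (ds_T s))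
          (lattice (2 * mu) (cs_U P)) (fun x u y => ds_T s (x, u, y))
          (out Sp) id.

End Design.

(* Main.v *)
Require Import Defs.
From HB Require Import structures.
From mathcomp Require Import all_boot all_order all_algebra.
From mathcomp Require Import all_classical all_reals all_analysis.
From mathcomp Require Import ess_sup_inf.
From mathcomp Require Import lra.
Import Order.TTheory GRing.Theory Num.Theory.
Import numFieldNormedType.Exports.
Local Open Scope classical_set_scope.
Local Open Scope ring_scope.

(** Call a point [x] safe if the diagonal pair [(x, x)] is a state of the
    non-blocking part [N] of the composition.  The composition is exact, so all
    its states are diagonal, and safe points are all of [N].  The relation
    between [(x, x)] and [x], for [x] a source of the final set [T] of triples,
    is an exact bisimulation because the final sources lie between two bounds.

    The sources are safe: when the loop stops, a target of [T] is neither bad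
    nor pending, hence is itself a source.  The diagonal copy of [T] is thus a
    non-blocking sub-system of the composition, and [N] contains it by
    maximality ([closed_triples_sub_Nb]).

    Conversely, safe points that the loop has discovered are sources, because
    no safe point is ever declared bad ([design_loop_sound]).  This rests on
    determinism of the specification ([symbolic_autonomous_inj]): its symbolic
    model has at most one successor [y] of [x], and the plant only gets to
    choose between following to [y] and blocking.  Hence the bad status of [y]
    propagates to all its predecessors ([Nb_match]), whichever input was
    recorded for them in [T]; and one recorded input per source is enough to
    match every transition of [N].

    Determinism uses no uniqueness theorem for differential equations: the
    incremental stability estimate, taken at distance zero for equal states and
    equal inputs, already forces the reached points to coincide, and the
    half-open boxes around lattice points are disjoint. *)

(** * Determinism of the symbolic specification *)

Lemma input_dist_refl {R : realType} {m : nat} (u : input R m) :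
  input_dist u u = 0%E.
Proof.
rewrite /input_dist (_ : (fun t : R => _) = cst 0%E).
  (* The goal sees R with a different but convertible measurable structure. *)
  apply: ess_sup_cst; have : (0 < lebesgue_measure [set: R])%E.
    by rewrite -set_itvNyy lebesgue_measure_itv /= addye // ltry.
  exact.
by apply/funext => t; rewrite subrr normr0 if_same.
Qed.

(** Instance of the stability estimate at distance zero, where the
    comparison functions vanish. *)
Lemma dISS_reach_inj {R : realType} {n m : nat} {S : ctrl_system R n m}
    {beta : R -> R -> R} {gamma : R -> R} {u : input R m} {x z z' : 'rV[R]_n}
    {t : R} :
  dISS S beta gamma -> 0 <= t -> cs_inputs S u ->
  reach S u x t z -> reach S u x t z' -> z = z'.
Proof.
move=> [_ [_ betaK _ _] [_ gamma0 _ _] stab] t0 Su xz xz'.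
have [_ beta0 _ _] := betaK t t0.
have := stab t x x z z' u u t0 Su Su xz xz'.
rewrite input_dist_refl subrr normr0 beta0 /= gamma0 addr0 => /(_ (ltry _)).
by rewrite normr_le0 subr_eq0 => /eqP.
Qed.

Lemma box_lattice_inj {R : realType} {n : nat} {eta : R} {A : set 'rV[R]_n}
    {y y' z : 'rV[R]_n} :
  0 < eta -> lattice (2 * eta) A y -> lattice (2 * eta) A y' ->
  box eta y z -> box eta y' z -> y = y'.
Proof.
(* The boxes around the lattice coordinates k and l overlap only if
   |k - l| < 1. *)
have le_coord (k l : int) (t : R) : 0 < eta -> k%:~R * (2 * eta) - eta <= t ->
    t < l%:~R * (2 * eta) + eta -> k <= l.
  move=> eta0 kt tl; rewrite -ltzD1 -(ltr_int R) intrD.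
  rewrite -(ltr_pM2r (_ : 0 < 2 * eta)) ?mulr_gt0// mulrDl; lra.
move=> eta0 [_ Ly] [_ Ly'] yz y'z; apply/rowP => i.
have [k yE] := Ly i; have [l y'E] := Ly' i.
have [] := yz i; have [] := y'z i; rewrite yE y'E => l1 l2 k1 k2.
suff -> : k = l by [].
by apply/le_anti; rewrite (le_coord k l (z 0 i))// (le_coord l k (z 0 i)).
Qed.

Lemma symbolic_autonomous_inj {R : realType} {n mq : nat}
    {Q : ctrl_system R n mq} {g : 'rV[R]_n -> 'rV[R]_n}
    {beta : R -> R -> R} {gamma : R -> R} {tau eta mu : R}
    {x y y' : 'rV[R]_n} {u u' : 'rV[R]_mq} :
  autonomous Q g -> dISS Q beta gamma -> 0 <= tau -> 0 < eta ->
  tr (symbolic Q tau eta mu) x u y -> tr (symbolic Q tau eta mu) x u' y' ->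
  y = y'.
Proof.
move=> [_ inpE _] Qs tau0 eta0.
move=> [_ _ Ly [v [z [Qv _ xz [yz _]]]]].
move=> [_ _ Ly' [v' [z' [Qv' _ xz' [yz' _]]]]].
have v'v : v' = v by move: Qv Qv'; rewrite inpE => -> ->.
rewrite v'v in xz'; rewrite -(dISS_reach_inj Qs tau0 Qv xz xz') in yz'.
exact: box_lattice_inj eta0 Ly Ly' yz yz'.
Qed.

(** * Safe points *)

Definition safe {R : realType} {n : nat} {In Out : Type}
    (N : system ('rV[R]_n * 'rV[R]_n) In Out) : set 'rV[R]_n :=
  [set x | st N (x, x)].

(** The only input symbol of the specification is [0], so a transition of the
    composition out of the diagonal is what the algorithm searches for. *)
Lemma compose0_tr_diag {R : realType} {n m mq : nat} {P : ctrl_system R n m}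
    {Q : ctrl_system R n mq} {g : 'rV[R]_n -> 'rV[R]_n} {tau eta mu : R}
    {x : 'rV[R]_n} {u : 'rV[R]_m * 'rV[R]_mq} {y : 'rV[R]_n * 'rV[R]_n} :
  autonomous Q g ->
  tr (compose0 (symbolic P tau eta mu) (symbolic Q tau eta 0)) (x, x) u y ->
  design_match P Q tau eta mu x u.1 y.1 /\ y = (y.1, y.1).
Proof.
case: u y => [u v] [y y'] [UQ _ _] [_ [_ _ /= yy'] /= xuy xvy].
have v0 : v = 0 by case: xvy => _ [+ _] _ _; rewrite UQ.
by rewrite v0 -yy' in xvy *.
Qed.

(** Safety propagates forward: [N] does not block at [(x, x)], and by
    determinism its transition there leads to the given [y].  By contraposition
    a single unsafe successor makes [x] unsafe, whatever the input. *)
Lemma Nb_match {R : realType} {n m mq : nat} {P : ctrl_system R n m}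
    {Q : ctrl_system R n mq} {g : 'rV[R]_n -> 'rV[R]_n} {tau eta mu : R}
    {N : system ('rV[R]_n * 'rV[R]_n) ('rV[R]_m * 'rV[R]_mq) 'rV[R]_n}
    {x : 'rV[R]_n} :
  autonomous Q g ->
  is_Nb (compose0 (symbolic P tau eta mu) (symbolic Q tau eta 0)) N ->
  safe N x ->
  exists u y, design_match P Q tau eta mu x u y /\ safe N y.
Proof.
move=> Qaut HN /(Nb_non_blocking HN) [u [y xuy]].
have [xy yE] := compose0_tr_diag Qaut (sub_tr (Nb_sub HN) xuy).
exists u.1, y.1; split=> //; rewrite /safe /= -yE.
by have [] := sys_tr (Nb_system HN) xuy.
Qed.

Definition diag_system {R : realType} {n m mq : nat}
    (C : system ('rV[R]_n * 'rV[R]_n) ('rV[R]_m * 'rV[R]_mq) 'rV[R]_n)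
    (T : set ('rV[R]_n * 'rV[R]_m * 'rV[R]_n)) :
    system ('rV[R]_n * 'rV[R]_n) ('rV[R]_m * 'rV[R]_mq) 'rV[R]_n :=
  System [set x | source T x.1 /\ x.2 = x.1]
    [set x | [/\ st0 C x, source T x.1 & x.2 = x.1]]
    (inp C)
    (fun x u y => [/\ T (x.1, u.1, y.1), x.2 = x.1, y.2 = y.1 & u.2 = 0])
    (out C) (Defs.omap C).

(** Since [T] leads from sources to sources, its diagonal copy never blocks, and
    maximality of [N] applies: this is how sources are seen to be safe. *)
Lemma closed_triples_sub_Nb {R : realType} {n m mq : nat}
    {P : ctrl_system R n m} {Q : ctrl_system R n mq} {tau eta mu : R}
    {N : system ('rV[R]_n * 'rV[R]_n) ('rV[R]_m * 'rV[R]_mq) 'rV[R]_n}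
    {T : set ('rV[R]_n * 'rV[R]_m * 'rV[R]_n)} :
  let C := compose0 (symbolic P tau eta mu) (symbolic Q tau eta 0) in
  is_Nb C N ->
  (forall x u y, T (x, u, y) -> design_match P Q tau eta mu x u y) ->
  (forall x u y, T (x, u, y) -> source T y) ->
  subsystem (diag_system C T) N.
Proof.
move=> C HN Tmatch Tclosed; apply: (Nb_max HN).
- split=> /=.
  + by move=> x [].
  + move=> [x x'] [u v] [y y'] /= [Txy -> -> ->].
    have [xy xuy] := Tmatch _ _ _ Txy.
    split; [by split=> //; exists u, y | | by split=> //; exact: Tclosed Txy].
    by case: xy => _ v0 _ _; case: xuy => _ uU _ _.
  + by [].
- move=> [x x'] /= [[u [y Txy]] ->].
  by exists (u, 0), (y, y).
split=> //=.
- move=> [x x'] /= [[u [y Txy]] ->].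
  by have [[? _ _ _] [? _ _ _]] := Tmatch _ _ _ Txy.
- by move=> x [].
move=> [x x'] [u v] [y y'] /= [Txy -> -> ->].
have [xy xuy] := Tmatch _ _ _ Txy.
by split=> //; split=> //=; [case: xuy | case: xy | case: xuy | case: xy].
Qed.

(** * Invariants of the algorithm *)

Lemma while_loop_invariant {A : Type} {guard : A -> Prop}
    {body : A -> A -> Prop} (I : A -> Prop) {s s' : A} :
  (forall s s1, guard s -> body s s1 -> I s -> I s1) ->
  while_loop guard body s s' -> I s -> I s' /\ ~ guard s'.
Proof.
move=> Ibody; elim=> {s s'} [s ngs Is //|s s1 s' gs ss1 _ IH Is].
exact/IH/(Ibody _ _ gs ss1).
Qed.

(** In each round the point moved to [Bad] loses all its incoming triples,
    which keeps bad points from being targets; the sources of those triples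
    are unsafe because safety propagates along [T]. *)
Lemma NonBlock_sound {St In : Type} {W : set St} {T T' : set (St * In * St)}
    {x : St} {Bad Bad' : set St} :
  (forall z u y, T (z, u, y) -> W z -> W y) ->
  (forall z u y, T (z, u, y) -> ~ Bad y) ->
  Bad `<=` ~` W -> ~ W x -> NonBlock T x Bad T' Bad' ->
  [/\ T' `<=` T, forall z u y, T' (z, u, y) -> ~ Bad' y & Bad' `<=` ~` W].
Proof.
move=> TW TBad BadW nWx [s' loop [<- <-]].
pose I (s : nonblock_state St In) := [/\ nb_T s `<=` T,
  forall z u y, nb_T s (z, u, y) -> ~ nb_Bad s y,
  nb_Bad s `<=` ~` W & nb_Badx s `<=` ~` W].
suff [[]] : I s' /\ ~ (nb_Badx s' !=set0) by [].
apply: (while_loop_invariant I _ loop); last by split=> // _ ->.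
move=> s _ _ [y sy ->] [sT sBad sBadW sW]; split=> /=.
- by move=> t [/sT].
- by move=> z u y' [/= /sBad sBady y'y] [].
- by move=> z [/sBadW|->] //; exact: sW.
- by move=> z [[/sW //|[u /sT Tzy] _ /(TW _ _ _ Tzy)]]; exact: sW.
Qed.

Record design_inv {R : realType} {n m mq : nat} (P : ctrl_system R n m)
    (Q : ctrl_system R n mq) (tau eta mu : R) (W : set 'rV[R]_n)
    (s : design_state 'rV[R]_n 'rV[R]_m) : Prop := DesignInv {
  inv_X0 : design_X0 P Q eta `<=` ds_target s;
  inv_match : forall x u y, ds_T s (x, u, y) ->
    design_match P Q tau eta mu x u y;
  inv_target : forall x u y, ds_T s (x, u, y) -> ds_target s y;
  inv_good : forall x u y, ds_T s (x, u, y) -> ~ ds_Bad s y;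
  inv_bad : ds_Bad s `<=` ~` W }.

Lemma design_body_inv {R : realType} {n m mq : nat} {P : ctrl_system R n m}
    {Q : ctrl_system R n mq} {tau eta mu : R} {W : set 'rV[R]_n}
    {s s' : design_state 'rV[R]_n 'rV[R]_m} :
  (forall x u y, design_match P Q tau eta mu x u y -> W x -> W y) ->
  (forall x, W x -> exists u y, design_match P Q tau eta mu x u y) ->
  design_body P Q tau eta mu s s' -> design_inv P Q tau eta mu W s ->
  design_inv P Q tau eta mu W s'.
Proof.
move=> Wstep Wmatch [x _ body] [X0s matchs targets goods bads].
case: body => [[u [y [xuy nBy ->]]]|[fail targetE NB]].
  split=> //=.
  - by move=> z /X0s; left.
  - by move=> z v w [/matchs|[-> -> ->]].
  - by move=> z v w [/targets|[_ _ ->]]; [left | right].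
  - by move=> z v w [/goods|[_ _ ->]].
(* Safe points are never given up. *)
have nWx : ~ W x.
  move=> Wx; have [u [y xuy]] := Wmatch _ Wx.
  have [/bads|] := fail y (proj1 xuy); last by apply; exists u.
  by apply; exact: Wstep xuy Wx.
have [sub good bad] := NonBlock_sound
  (fun z u y Tzy => Wstep z u y (matchs z u y Tzy)) goods bads nWx NB.
split=> //; rewrite ?targetE //.
- by move=> z u y /sub /matchs.
- by move=> z u y /sub /targets.
Qed.

(** A state at which the loop stops is closed: discovered points of the
    lattice that are not bad are sources. *)
Lemma design_loop_sound {R : realType} {n m mq : nat} {P : ctrl_system R n m}
    {Q : ctrl_system R n mq} {tau eta mu : R} {W : set 'rV[R]_n}
    {s : design_state 'rV[R]_n 'rV[R]_m} :
  (forall x u y, design_match P Q tau eta mu x u y -> W x -> W y) ->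
  (forall x, W x -> exists u y, design_match P Q tau eta mu x u y) ->
  while_loop (design_guard P Q eta) (design_body P Q tau eta mu)
    (design_init P Q eta) s ->
  [/\ forall x u y, ds_T s (x, u, y) -> design_match P Q tau eta mu x u y,
      forall x u y, ds_T s (x, u, y) -> source (ds_T s) y &
      design_X0 P Q eta `&` W `<=` source (ds_T s)].
Proof.
move=> Wstep Wmatch loop.
have [||[X0s matchs targets goods bads] stop] :=
    while_loop_invariant (design_inv P Q tau eta mu W) _ loop.
- by move=> s1 s2 _; exact: design_body_inv.
- by split.
have sourceP x : lattice (2 * eta) (cs_X P `&` cs_X Q) x -> ds_target s x ->
    ~ ds_Bad s x -> source (ds_T s) x.
  by move=> Xx sx nBx; apply: contrapT => nsx; apply: stop; exists x.
split=> //.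
- move=> x u y Txy; apply: sourceP; [|exact: targets Txy|exact: goods Txy].
  by have [[_ _ [Qy Ly] _] [_ _ [Py _] _]] := matchs _ _ _ Txy.
- move=> x [X0x Wx]; apply: sourceP; [|exact: X0s|by move=> /bads].
  by case: X0x => -[/cs_X0_sub Px /cs_X0_sub Qx] Lx.
Qed.

(** * The bisimulation *)

Theorem theorem5p2 (R : realType) (n m mq : nat)
  (P : ctrl_system R n m) (Q : ctrl_system R n mq)
  (gq : 'rV[R]_n -> 'rV[R]_n)
  (betap : R -> R -> R) (gammap : R -> R)
  (betaq : R -> R -> R) (gammaq : R -> R)
  (eps thetap thetaq tau eta mu : R)
  (HQ : autonomous Q gq)
  (HXp : bounded_set (cs_X P)) (HUp : bounded_set (cs_U P))
  (HXq : bounded_set (cs_X Q))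
  (HdP : dISS P betap gammap) (HdQ : dISS Q betaq gammaq)
  (Heps : 0 < eps) (Hthetap : 0 < thetap) (Hthetaq : 0 < thetaq)
  (Htau : 0 < tau) (Heta : 0 < eta) (Hmu : 0 < mu)
  (Htheta : thetap + thetaq <= eps)
  (Hp : betap thetap tau + gammap mu + eta <= thetap)
  (Hq : betaq thetaq tau + eta <= thetaq)
  (Nb : system ('rV[R]_n * 'rV[R]_n) ('rV[R]_m * 'rV[R]_mq) 'rV[R]_n)
  (HNb : is_Nb (compose0 (symbolic P tau eta mu) (symbolic Q tau eta 0)) Nb)
  (Css : system 'rV[R]_n 'rV[R]_m 'rV[R]_n)
  (HCss : design_output P Q tau eta mu Css) :
  exists rel : ('rV[R]_n * 'rV[R]_n) -> 'rV[R]_n -> Prop,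
    approx_bisim Nb Css 0 rel.
Proof.
case: HCss => s loop ->; set T := ds_T s in loop *.
have Qdet x y y' u u' := @symbolic_autonomous_inj R n mq Q gq betaq gammaq tau
  eta 0 x y y' u u' HQ HdQ (ltW Htau) Heta.
have safe_match x (Nx : safe Nb x) := Nb_match HQ HNb Nx.
have safe_step x u y : design_match P Q tau eta mu x u y ->
    safe Nb x -> safe Nb y.
  move=> [xy _] /safe_match [u' [y' [[xy' _] Ny']]].
  by rewrite (Qdet _ _ _ _ _ xy xy').
have [Tmatch Tclosed X0T] := design_loop_sound safe_step
  (fun x Nx => let: ex_intro u (ex_intro y (conj xuy _)) := safe_match x Nx in
               ex_intro _ u (ex_intro _ y xuy)) loop.
have TNb := closed_triples_sub_Nb HNb Tmatch Tclosed.
exists (fun p x => p = (x, x) /\ source T x); split; split=> //=.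
- by move=> p x [-> Tx]; split=> //; apply: (sub_st TNb).
- move=> [x x'] N0x; have [[_ _ /= xx'] [[Px Lx] P0x] [_ Q0x]] :=
    sub_st0 (Nb_sub HNb) N0x.
  have Nx := sys_st0 (Nb_system HNb) N0x.
  rewrite /= -xx' in Nx Q0x *.
  have X0x : design_X0 P Q eta x by [].
  by exists x; [split=> //; exact: X0T | split=> //; exact: X0T].
- move=> p x [-> Tx]; rewrite (sub_omap (Nb_sub HNb)) ?subrr ?normr0 //.
  exact: (sub_st TNb).
- move=> p x u y [-> [v [y' Txy']]] /(sub_tr (Nb_sub HNb)).
  move=> /(compose0_tr_diag HQ) [[xy _] ->].
  have [xy' _] := Tmatch _ _ _ Txy'.
  (* The input recorded in [T] may differ from [u]; the successor cannot. *)
  rewrite (Qdet _ _ _ _ _ xy xy').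
  by exists v, y'; split=> //; split=> //; exact: Tclosed Txy'.
- by move=> x p [-> Tx]; split=> //; apply: (sub_st TNb).
- move=> x [[[P0x Q0x] Lx] Tx]; exists (x, x) => //; apply: (sub_st0 TNb).
  by split=> //; do ?split=> //=; exact: cs_X0_sub.
- move=> x p [-> Tx]; rewrite (sub_omap (Nb_sub HNb)) ?subrr ?normr0 //.
  exact: (sub_st TNb).
- move=> x p u y [-> Tx] Txy; exists (u, 0), (y, y); split.
    exact: (sub_tr TNb).
  by split=> //; exact: Tclosed Txy.
Qed.
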